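(* For every $w_0\in M_N(\mathbb C)$, the Hamilton equation $$\dot w=|w|^q-|w^*|^q,\qquad w(0)=w_0$$ has a unique continuously differentiable solution $w:\mathbb R\to M_N(\mathbb C)$, defined for all $t\in\mathbb R$.
   Context: $p=2n\ge2$ is a fixed even integer and $q=p/(p-1)$. For $x\in M_N(\mathbb C)$, $|x|=(x^*x)^{1/2}$ and $|x^*|=(xx^* )^{1/2}$ (positive square roots), and $|x|^q$ is defined by functional calculus. *)

(* Defs.v *)
From HB Require Import structures.
From mathcomp Require Import all_boot all_order all_algebra.
From mathcomp Require Import all_classical all_reals all_analysis.
From mathcomp Require Import complex.
Import numFieldNormedType.Exports.
Set Implicit Arguments. Unset Strict Implicit. Unset Printing Implicit Defensive.
Import Order.TTheory GRing.Theory Num.Theory.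
Local Open Scope ring_scope.

Section MatFun.
Variables (R : realType) (N : nat).
Local Notation C := R[i].

Definition adjmx (x : 'M[C]_N) : 'M[C]_N := (map_mx (@conjc R) x)^T.

Definition unitarymx (U : 'M[C]_N) : Prop := U *m adjmx U = 1%:M.

Definition spectral_decomp (H : 'M[C]_N) (Ud : 'M[C]_N * 'rV[C]_N) : Prop :=
  unitarymx Ud.1 /\ H = Ud.1 *m diag_mx Ud.2 *m adjmx Ud.1.

(* functional calculus f(H) for a real function f, on matrices admitting a
   unitary diagonalisation (in particular self-adjoint ones, whose eigenvalues
   are real); defined as U diag(f(d)) U^* for a chosen decomposition.
   (Irrelevant default 0 for matrices without such a decomposition.) *)
Definition mxfun (f : R -> R) (H : 'M[C]_N) : 'M[C]_N :=
  match pselect (exists Ud, spectral_decomp H Ud) with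
  | left ex => let Ud := projT1 (cid ex) in
      Ud.1 *m diag_mx (map_mx (fun z : C => Complex (f (complex.Re z)) 0) Ud.2) *m adjmx Ud.1
  | right _ => 0
  end.

Definition absmx (x : 'M[C]_N) : 'M[C]_N := mxfun (fun t => powR t (2^-1)) (adjmx x *m x).

Definition absmx_pow (q : R) (x : 'M[C]_N) : 'M[C]_N := mxfun (fun t => powR t q) (absmx x).

Definition hamfield (q : R) (w : 'M[C]_N) : 'M[C]_N :=
  absmx_pow q w - absmx_pow q (adjmx w).

Definition C1_solution (F : 'M[C]_N -> 'M[C]_N) (w0 : 'M[C]_N) (w : R -> 'M[C]_N) : Prop :=
  w 0 = w0 /\
  forall i j : 'I_N,
    (forall t : R,
      is_derive t 1 (fun s => complex.Re (w s i j)) (complex.Re (F (w t) i j)) /\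
      is_derive t 1 (fun s => complex.Im (w s i j)) (complex.Im (F (w t) i j))) /\
    continuous (fun t : R => complex.Re (F (w t) i j)) /\
    continuous (fun t : R => complex.Im (F (w t) i j)).

End MatFun.

(* Main.v *)
Require Import Defs.
From HB Require Import structures.
From mathcomp Require Import all_boot all_order all_algebra.
From mathcomp Require Import all_classical all_reals all_analysis.
From mathcomp Require Import complex.
From mathcomp Require Import ring lra.
Import Order.TTheory GRing.Theory Num.Theory.
Local Open Scope ring_scope.

Set Implicit Arguments. Unset Strict Implicit. Unset Printing Implicit Defensive.

(** Since [x^* f(x x^* ) = f(x^* x) x^*], the field [|w|^q - |w^*|^q] is orthogonal
    to [w] for the trace form, so the Frobenius norm is conserved and the power
    may be truncated at a large spectral parameter without changing any solution.
    The truncated field is globally Lipschitz: for self-adjoint [A], [B] written in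
    eigenbases, [f(A) - f(B)] and [A - B] have the entries [(f(a_i) - f(b_j)) W_ij]
    and [(a_i - b_j) W_ij] with the same [W], so [f] is as Lipschitz on matrices
    for the Frobenius norm as on the line; this is applied to [f(t) = min(|t|, M)^q]
    and to the self-adjoint dilation of [w].  Global existence and
    uniqueness then follow from Picard iteration in the weight [exp(2L|t|)], for
    which the Picard map halves distances. *)

(** * Functional calculus *)

Section Matrices.
Variables (R : realType).
Local Notation C := R[i].
Implicit Types (m n N : nat).

(* [adjmx] for rectangular matrices, convertible to it on square ones. *)
Definition cadj m n (x : 'M[C]_(m, n)) : 'M[C]_(n, m) := (map_mx (@conjc R) x)^T.

Lemma conjmx_tr m n (x : 'M[C]_(m, n)) :
  map_mx (@Num.conj C) x^T = cadj x.
Proof. by apply/matrixP => i j; rewrite !mxE. Qed.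

Lemma cadjM m n p (x : 'M[C]_(m, n)) (y : 'M[C]_(n, p)) :
  cadj (x *m y) = cadj y *m cadj x.
Proof. by rewrite /cadj map_mxM trmx_mul. Qed.

Lemma cadjK m n (x : 'M[C]_(m, n)) : cadj (cadj x) = x.
Proof. by apply/matrixP => i j; rewrite !mxE conjcK. Qed.

Lemma cadjB m n (x y : 'M[C]_(m, n)) : cadj (x - y) = cadj x - cadj y.
Proof. by apply/matrixP => i j; rewrite !mxE rmorphB. Qed.

Lemma unitarymx_mulV N (U : 'M[C]_N) : Defs.unitarymx U -> cadj U *m U = 1%:M.
Proof. exact: mulmx1C. Qed.

(** The eigenvalues form a real row, so that a real [f] acts on them without taking real parts. *)
Definition real_spectral N (H U : 'M[C]_N) (d : 'rV[R]_N) :=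
  Defs.unitarymx U /\ H = U *m diag_mx (map_mx (real_complex R) d) *m cadj U.

Lemma hermitian_real_spectral N (H : 'M[C]_N) : cadj H = H ->
  exists U d, real_spectral H U d.
Proof.
move=> hH.
have hs : H \is hermsymmx.
  by apply/is_hermitianmxP; rewrite expr0 scale1r conjmx_tr hH.
have /orthomx_spectralP E := hermitian_normalmx hs.
(* The spectral theorem for normal matrices gives [H = P^-1 D P] with [P] unitary, so the eigenbasis
   is the adjoint of [P]; the entries of [D] are real because [H] is self-adjoint. *)
exists (cadj (spectralmx H)), (map_mx (@complex.Re R) (spectral_diag H)); split.
  have /unitarymxP := spectral_unitarymx H; rewrite conjmx_tr => U1.
  by rewrite /Defs.unitarymx -[adjmx _]/(cadj (cadj _)) cadjK; apply: mulmx1C.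
rewrite cadjK {1}E (invmx_unitary (spectral_unitarymx H)) conjmx_tr.
congr (_ *m diag_mx _ *m _); apply/rowP => j; rewrite !mxE RRe_real//.
by have /mxOverP := hermitian_spectral_diag_real hs; apply.
Qed.

Definition spectral_fun N (f : R -> R) (U : 'M[C]_N) (d : 'rV[R]_N) : 'M[C]_N :=
  U *m diag_mx (map_mx (fun t => (f t)%:C%C) d) *m cadj U.

Lemma mul_diag_mx_diagE m n (a : 'rV[C]_m) (b : 'rV[C]_n) (W : 'M[C]_(m, n)) i j :
  (diag_mx a *m W - W *m diag_mx b) i j = (a 0 i - b 0 j) * W i j.
Proof. by rewrite mul_diag_mx mul_mx_diag !mxE mulrBl [W i j * _]mulrC. Qed.

(* In the two eigenbases, the entry W i j of an intertwiner vanishes unless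
   a_i = b_j. *)
Lemma spectral_intertwine m n (f : C -> C) (U : 'M[C]_m) (V : 'M[C]_n)
    (a : 'rV[C]_m) (b : 'rV[C]_n) (X : 'M[C]_(m, n)) :
  Defs.unitarymx U -> Defs.unitarymx V ->
  U *m diag_mx a *m cadj U *m X = X *m (V *m diag_mx b *m cadj V) ->
  U *m diag_mx (map_mx f a) *m cadj U *m X =
  X *m (V *m diag_mx (map_mx f b) *m cadj V).
Proof.
move=> uU uV E.
have uU' := unitarymx_mulV uU; have uV' := unitarymx_mulV uV.
pose W := cadj U *m X *m V.
have XW : X = U *m W *m cadj V.
  by rewrite /W !mulmxA uU mul1mx -!mulmxA uV mulmx1.
have EW : diag_mx a *m W = W *m diag_mx b.
  have := congr1 (fun Z => cadj U *m Z *m V) E.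
  by rewrite !mulmxA uU' mul1mx -!mulmxA uV' mulmx1 !mulmxA.
clearbody W; have FW : diag_mx (map_mx f a) *m W = W *m diag_mx (map_mx f b).
  apply/matrixP => i j; move/matrixP/(_ i j): EW.
  rewrite !mul_diag_mx !mul_mx_diag !mxE ![W i j * _]mulrC => EW.
  have [->|W0] := eqVneq (W i j) 0; first by rewrite !mulr0.
  by rewrite (mulIf W0 EW).
rewrite XW !mulmxA -[_ *m cadj U *m U]mulmxA uU' mulmx1.
rewrite -[U *m W *m cadj V *m V]mulmxA uV' mulmx1.
by rewrite -[U *m W *m diag_mx _]mulmxA -FW !mulmxA.
Qed.

(** Independence of the chosen diagonalisation: two of them are intertwined by the identity
    matrix. *)
Lemma mxfunE N (f : R -> R) (H U : 'M[C]_N) (d : 'rV[R]_N) :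
  real_spectral H U d -> mxfun f H = spectral_fun f U d.
Proof.
move=> [uU HE]; rewrite /mxfun; case: pselect => [ex|[]]; last first.
  by exists (U, map_mx (real_complex R) d).
case: (cid ex) => -[V e] /= [/= uV HE'].
have := @spectral_intertwine _ _ (fun z => (f (complex.Re z))%:C%C) V U e
  (map_mx (real_complex R) d) 1%:M uV uU.
rewrite !mulmx1 !mul1mx => ->; last by rewrite -HE -[cadj V]/(adjmx V) -HE'.
by rewrite /spectral_fun -map_mx_comp.
Qed.

Lemma mxfun_intertwine m n (f : R -> R) (A : 'M[C]_m) (B : 'M[C]_n)
    (X : 'M[C]_(m, n)) :
  cadj A = A -> cadj B = B -> A *m X = X *m B ->
  mxfun f A *m X = X *m mxfun f B.
Proof.
move=> /hermitian_real_spectral[U [a hA]] /hermitian_real_spectral[V [b hB]] AB.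
rewrite (mxfunE f hA) (mxfunE f hB) /spectral_fun.
have := @spectral_intertwine _ _ (fun z => (f (complex.Re z))%:C%C) U V
  (map_mx (real_complex R) a) (map_mx (real_complex R) b) X hA.1 hB.1.
by rewrite -!map_mx_comp -hA.2 -hB.2 => /(_ AB).
Qed.

Lemma real_spectral_mxfun N (f : R -> R) (H U : 'M[C]_N) (d : 'rV[R]_N) :
  real_spectral H U d -> real_spectral (mxfun f H) U (map_mx f d).
Proof.
move=> hH; split; first exact: hH.1.
by rewrite (mxfunE f hH) /spectral_fun -map_mx_comp.
Qed.

Lemma mxfun_comp N (f g : R -> R) (H : 'M[C]_N) : cadj H = H ->
  mxfun g (mxfun f H) = mxfun (g \o f) H.
Proof.
move=> /hermitian_real_spectral[U [d hH]].
rewrite (mxfunE _ (real_spectral_mxfun f hH)) (mxfunE _ hH) /spectral_fun.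
by rewrite -map_mx_comp.
Qed.

(** * The squared Frobenius norm [frob] and Lipschitz functions of self-adjoint matrices *)

Definition frob m n (x : 'M[C]_(m, n)) : R := \sum_i \sum_j
  (complex.Re (x i j) ^+ 2 + complex.Im (x i j) ^+ 2).

Lemma frob_trace m n (x : 'M[C]_(m, n)) : (frob x)%:C%C = \tr (cadj x *m x).
Proof.
rewrite /frob /mxtrace exchange_big/= rmorph_sum; apply: eq_bigr => j _.
rewrite mxE rmorph_sum; apply: eq_bigr => i _; rewrite !mxE.
by rewrite [LHS]add_Re2_Im2 sqr_normc mulrC.
Qed.

Lemma frob_unitary m n (U : 'M[C]_m) (V : 'M[C]_n) (x : 'M[C]_(m, n)) :
  Defs.unitarymx U -> Defs.unitarymx V -> frob (cadj U *m x *m V) = frob x.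
Proof.
rewrite /Defs.unitarymx => uU uV; apply: complexI; rewrite !frob_trace !cadjM cadjK.
rewrite -[adjmx _]/(cadj _) in uU; rewrite -[adjmx _]/(cadj _) in uV.
rewrite -!mulmxA [U *m (cadj U *m _)]mulmxA uU mul1mx mxtrace_mulC.
by rewrite -!mulmxA uV mulmx1.
Qed.

Lemma frob_ge0 m n (x : 'M[C]_(m, n)) : 0 <= frob x.
Proof.
by apply/sumr_ge0 => i _; apply/sumr_ge0 => j _; rewrite addr_ge0 ?sqr_ge0.
Qed.

Lemma frob_entry m n (x : 'M[C]_(m, n)) i j :
  complex.Re (x i j) ^+ 2 + complex.Im (x i j) ^+ 2 <= frob x.
Proof.
rewrite /frob (bigD1 i)//= (bigD1 j)//= -addrA lerDl addr_ge0//.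
  by apply/sumr_ge0 => k _; rewrite addr_ge0 ?sqr_ge0.
by apply/sumr_ge0 => k _; apply/sumr_ge0 => l _; rewrite addr_ge0 ?sqr_ge0.
Qed.

Lemma frob_le m n (L : R) (x y : 'M[C]_(m, n)) :
  (forall i j, complex.Re (x i j) ^+ 2 + complex.Im (x i j) ^+ 2 <=
    L * (complex.Re (y i j) ^+ 2 + complex.Im (y i j) ^+ 2)) ->
  frob x <= L * frob y.
Proof.
move=> xy; rewrite /frob mulr_sumr; apply: ler_sum => i _.
by rewrite mulr_sumr; apply: ler_sum => j _; exact: xy.
Qed.

Lemma sqnorm_realM (r : R) (z : C) :
  complex.Re (r%:C%C * z) ^+ 2 + complex.Im (r%:C%C * z) ^+ 2 =
  r ^+ 2 * (complex.Re z ^+ 2 + complex.Im z ^+ 2).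
Proof. by case: z => x y; rewrite /= !mul0r subr0 addr0 !exprMn mulrDr. Qed.

(** As [frob] is a squared norm, [L] is the square of a Lipschitz constant. *)
Lemma mxfun_lipschitz N (f : R -> R) (L : R) (A B : 'M[C]_N) :
  cadj A = A -> cadj B = B ->
  (forall s t, (f s - f t) ^+ 2 <= L * (s - t) ^+ 2) ->
  frob (mxfun f A - mxfun f B) <= L * frob (A - B).
Proof.
move=> /hermitian_real_spectral[U [a hA]] /hermitian_real_spectral[V [b hB]] fL.
have uU' := unitarymx_mulV hA.1; have uV' := unitarymx_mulV hB.1.
pose W := cadj U *m V.
(* Multiplying by the adjoint of [U] on the left and by [V] on the right preserves [frob] and
   expresses the difference in the mixed eigenbases. *)
have E (c d : 'rV[C]_N) :
  frob (U *m diag_mx c *m cadj U - V *m diag_mx d *m cadj V) =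
  frob (diag_mx c *m W - W *m diag_mx d).
  rewrite -[LHS](frob_unitary _ hA.1 hB.1) mulmxBr mulmxBl.
  by rewrite !mulmxA uU' mul1mx -!mulmxA uV' mulmx1 !mulmxA.
have EAB : frob (A - B) = frob (diag_mx (map_mx (real_complex R) a) *m W -
    W *m diag_mx (map_mx (real_complex R) b)).
  by rewrite hA.2 hB.2; exact: E.
have -> : frob (mxfun f A - mxfun f B) =
    frob (diag_mx (map_mx (fun t => (f t)%:C%C) a) *m W -
          W *m diag_mx (map_mx (fun t => (f t)%:C%C) b)).
  by rewrite (mxfunE f hA) (mxfunE f hB); exact: E.
rewrite EAB; clearbody W; apply: frob_le => i j; rewrite 2!mul_diag_mx_diagE.
move: (W i j) => z; rewrite ![map_mx _ _ _ _]mxE -!rmorphB/= !sqnorm_realM mulrA.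
by rewrite ler_wpM2r ?addr_ge0 ?sqr_ge0.
Qed.

Lemma frob_cadj m n (x : 'M[C]_(m, n)) : frob (cadj x) = frob x.
Proof.
rewrite /frob exchange_big; apply: eq_bigr => i _; apply: eq_bigr => j _.
by rewrite !mxE; case: (x i j) => a b /=; rewrite sqrrN.
Qed.

Lemma frob_block m1 m2 n1 n2 (A : 'M[C]_(m1, n1)) (B : 'M[C]_(m1, n2))
    (D : 'M[C]_(m2, n1)) (E : 'M[C]_(m2, n2)) :
  frob (block_mx A B D E) = frob A + frob B + (frob D + frob E).
Proof.
rewrite /frob big_split_ord/= -!big_split/=; congr (_ + _);
  apply: eq_bigr => i _; rewrite big_split_ord/=; congr (_ + _);
  apply: eq_bigr => j _;
  by rewrite ?(block_mxEul, block_mxEur, block_mxEdl, block_mxEdr).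
Qed.

Lemma frobB_le m n (A B : 'M[C]_(m, n)) : frob (A - B) <= 2 * frob A + 2 * frob B.
Proof.
rewrite /frob !mulr_sumr -big_split/= ler_sum// => i _.
rewrite !mulr_sumr -big_split/= ler_sum// => j _; rewrite !mxE.
case: (A i j) (B i j) => a b [c d] /=.
have := sqr_ge0 (a + c); have := sqr_ge0 (b + d); nra.
Qed.

Lemma frob0 m n : frob (0 : 'M[C]_(m, n)) = 0.
Proof.
by rewrite /frob big1// => i _; rewrite big1// => j _; rewrite mxE /= expr0n addr0.
Qed.

(** * Functions of [x^* x]: self-adjoint dilation, spectral bound, difference field *)

Lemma mxfun_sqr N (H : 'M[C]_N) : cadj H = H ->
  mxfun (fun t => t ^+ 2) H = H *m H.
Proof.
move=> /hermitian_real_spectral[U [d hH]]; rewrite (mxfunE _ hH) /spectral_fun hH.2.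
rewrite !mulmxA -[_ *m cadj U *m U]mulmxA (unitarymx_mulV hH.1) mulmx1.
rewrite -[U *m _ *m diag_mx _]mulmxA mulmx_diag.
congr (_ *m diag_mx _ *m _); apply/rowP => j; rewrite !mxE -rmorphM.
by rewrite expr2.
Qed.

(* The self-adjoint dilation [[0, x^*], [x, 0]]: its square has the corner x^* x,
   so that |x| is read off a function of a matrix depending linearly on x. *)
Definition dilation m n (x : 'M[C]_(m, n)) : 'M[C]_(n + m) :=
  block_mx 0 (cadj x) x 0.

Lemma cadj0 m n : cadj (0 : 'M[C]_(m, n)) = 0.
Proof. by apply/matrixP => i j; rewrite !mxE conjc0. Qed.

Lemma cadj_dilation m n (x : 'M[C]_(m, n)) : cadj (dilation x) = dilation x.
Proof.
rewrite /dilation {1}/cadj map_block_mx tr_block_mx -!/(cadj _) !cadj0.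
by rewrite cadjK.
Qed.

Lemma cadj_gram m n (x : 'M[C]_(m, n)) : cadj (cadj x *m x) = cadj x *m x.
Proof. by rewrite cadjM cadjK. Qed.

(** The square of the dilation is block diagonal with blocks [x^* x] and [x x^*], so the block row
    [(1, 0)] intertwines it with [x^* x]; this passes to functions of both. *)
Lemma mxfun_gram_dilation m n (h : R -> R) (x : 'M[C]_(m, n)) :
  mxfun h (cadj x *m x) = ulsubmx (mxfun (fun t => h (t ^+ 2)) (dilation x)).
Proof.
have dx := cadj_dilation x.
rewrite -[fun t => _]/(h \o (fun t => t ^+ 2)) -(mxfun_comp _ h dx) mxfun_sqr//.
set S := dilation x; pose E : 'M[C]_(n, n + m) := row_mx 1%:M 0.
have ES : cadj x *m x *m E = E *m (S *m S).
  rewrite /E /S /dilation mulmx_block mul_mx_row mul_row_block.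
  by rewrite !(mulmx0, mul0mx, mulmx1, mul1mx, add0r, addr0).
have hS : cadj (S *m S) = S *m S by rewrite cadjM dx.
have := mxfun_intertwine h (cadj_gram x) hS ES.
move: (mxfun h (S *m S)) => M; rewrite -{1}(submxK M) /E mul_mx_row mul_row_block.
by rewrite !(mulmx0, mul0mx, mulmx1, mul1mx, add0r, addr0) => /eq_row_mx[].
Qed.

Lemma frob_dilationB m n (x y : 'M[C]_(m, n)) :
  frob (dilation x - dilation y) = 2 * frob (x - y).
Proof.
rewrite /dilation opp_block_mx add_block_mx !subr0 -cadjB frob_block.
by rewrite frob_cadj !frob0 add0r addr0 [RHS]mulr_natl mulr2n.
Qed.

(** The condition bears on [h] of a square, a function of singular values; [h] itself, like a power
    below 1, may fail to be Lipschitz at 0. The factor 2 counts the two copies of [x] in the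
    dilation, and taking a corner does not increase [frob]. *)
Lemma mxfun_gram_lipschitz m n (h : R -> R) (L : R) (x y : 'M[C]_(m, n)) :
  (forall s t, (h (s ^+ 2) - h (t ^+ 2)) ^+ 2 <= L * (s - t) ^+ 2) ->
  frob (mxfun h (cadj x *m x) - mxfun h (cadj y *m y)) <= L * (2 * frob (x - y)).
Proof.
move=> hL; rewrite !mxfun_gram_dilation.
have := @mxfun_lipschitz _ (fun t => h (t ^+ 2)) L _ _ (cadj_dilation x)
  (cadj_dilation y) hL.
rewrite frob_dilationB.
apply: le_trans; set A := mxfun _ _; set B := mxfun _ _.
rewrite -[in leRHS](submxK A) -[in leRHS](submxK B).
rewrite opp_block_mx add_block_mx frob_block -addrA lerDl.
by rewrite !addr_ge0 ?frob_ge0.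
Qed.

(** [d 0 j] is the squared length of column [j] of [x U], and these squares add up to [frob x]. *)
Lemma gram_spectrum m n (x : 'M[C]_(m, n)) (U : 'M[C]_n) (d : 'rV[R]_n) j :
  real_spectral (cadj x *m x) U d -> 0 <= d 0 j <= frob x.
Proof.
move=> [uU E]; pose y := x *m U.
have yy : cadj y *m y = diag_mx (map_mx (real_complex R) d).
  rewrite cadjM -mulmxA [cadj x *m _]mulmxA E !mulmxA.
  by rewrite (unitarymx_mulV uU) mul1mx -mulmxA (unitarymx_mulV uU) mulmx1.
have u1 : Defs.unitarymx (1%:M : 'M[C]_m).
  rewrite /Defs.unitarymx mul1mx /adjmx map_mx1 trmx1 //.
have fy : frob y = frob x.
  by rewrite -(frob_unitary x u1 uU) /cadj map_mx1 trmx1 mul1mx.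
have dj : d 0 j = \sum_i (complex.Re (y i j) ^+ 2 + complex.Im (y i j) ^+ 2).
  apply: complexI; move/matrixP/(_ j j): yy; rewrite !mxE eqxx mulr1n => <-.
  rewrite rmorph_sum; apply: eq_bigr => i _; rewrite !mxE.
  by rewrite [RHS]add_Re2_Im2 sqr_normc mulrC.
rewrite -fy /frob exchange_big/= (bigD1 j)//= -dj lerDl.
apply/andP; split.
  by rewrite dj; apply/sumr_ge0 => i _; rewrite addr_ge0 ?sqr_ge0.
by apply/sumr_ge0 => k _; apply/sumr_ge0 => l _; rewrite addr_ge0 ?sqr_ge0.
Qed.

(** This lets the power be exchanged for its truncation once [frob x] is bounded. *)
Lemma mxfun_gram_eq m n (h k : R -> R) (x : 'M[C]_(m, n)) :
  (forall s, 0 <= s <= frob x -> h s = k s) ->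
  mxfun h (cadj x *m x) = mxfun k (cadj x *m x).
Proof.
move=> hk; have [U [d hd]] := hermitian_real_spectral (cadj_gram x).
rewrite !(mxfunE _ hd) /spectral_fun; congr (_ *m diag_mx _ *m _); apply/rowP => j.
by rewrite !mxE hk// (gram_spectrum _ hd).
Qed.

(* The second term, h(x x^* ), is written as the first one at x^*. *)
Definition gramfield N (h : R -> R) (x : 'M[C]_N) : 'M[C]_N :=
  mxfun h (cadj x *m x) - mxfun h (cadj (cadj x) *m cadj x).

(** Each of the two terms gives [2 L frob (x - y)], and [frobB_le] doubles both. *)
Lemma gramfield_lipschitz N (h : R -> R) (L : R) (x y : 'M[C]_N) :
  (forall s t, (h (s ^+ 2) - h (t ^+ 2)) ^+ 2 <= L * (s - t) ^+ 2) ->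
  frob (gramfield h x - gramfield h y) <= 8 * L * frob (x - y).
Proof.
move=> hL; rewrite /gramfield opprD addrACA -opprD.
apply: le_trans (frobB_le _ _) _.
have h1 := mxfun_gram_lipschitz x y hL.
have := mxfun_gram_lipschitz (cadj x) (cadj y) hL.
rewrite -cadjB frob_cadj; lra.
Qed.

Lemma gramfield_eq N (h k : R -> R) (x : 'M[C]_N) :
  (forall s, 0 <= s <= frob x -> h s = k s) -> gramfield h x = gramfield k x.
Proof.
move=> hk; rewrite /gramfield (mxfun_gram_eq hk) (@mxfun_gram_eq _ _ h k)//.
by move=> s; rewrite frob_cadj; exact: hk.
Qed.

(** The sum is the real part of the trace of [x^* y], with [y] the field at [x]. Its two terms
    cancel by [x^* h(x x^* ) = h(x^* x) x^*] and cyclicity of the trace. *)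
Lemma gramfield_orthogonal N (h : R -> R) (x : 'M[C]_N) :
  \sum_i \sum_j (complex.Re (x i j) * complex.Re (gramfield h x i j) +
                 complex.Im (x i j) * complex.Im (gramfield h x i j)) = 0.
Proof.
have tr0 : \tr (cadj x *m gramfield h x) = 0.
  rewrite /gramfield cadjK mulmxBr linearB/=.
  rewrite -(@mxfun_intertwine _ _ h (cadj x *m x) (x *m cadj x)).
  - by rewrite mxtrace_mulC subrr.
  - exact: cadj_gram.
  - by have := cadj_gram (cadj x); rewrite cadjK.
  - by rewrite mulmxA.
have := congr1 (@complex.Re R) tr0; rewrite /mxtrace raddf_sum/= => {}tr0.
rewrite -[RHS]tr0 {tr0}.
move: (gramfield h x) => y; rewrite exchange_big /=; apply: eq_bigr => j _.
rewrite mxE raddf_sum; apply: eq_bigr => i _; rewrite !mxE.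
by case: (x i j) (y i j) => a b [c d] /=; rewrite mulNr opprK.
Qed.

(** * The power function and its truncation *)

Lemma hamfieldE N (q : R) (x : 'M[C]_N) :
  hamfield q x = gramfield (fun s => (s `^ 2^-1) `^ q) x.
Proof.
by congr (_ - _); rewrite /absmx_pow /absmx mxfun_comp//; exact: cadj_gram.
Qed.

(** With [al = q - 1] and [s <= t], the product [(t - s) (s^al + t^al)] equals [t^q - s^q] plus
    [t s^al - s t^al], which is nonnegative by [swap]; both powers are at most [M^al]. *)
Lemma powR_lipschitz (q M s t : R) : 1 < q <= 2 -> 0 <= s <= M -> 0 <= t <= M ->
  `|s `^ q - t `^ q| <= 2 * M `^ (q - 1) * `|s - t|.
Proof.
move=> /andP[q1 q2] sM tM; wlog st : s t sM tM / s <= t => [W|].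
  by case/orP: (le_total s t) => st; [|rewrite distrC (distrC s)]; exact: W.
move: sM tM => /andP[s0 sM] /andP[t0 tM].
have tst : s `^ q <= t `^ q by rewrite ge0_ler_powR ?nnegrE//; lra.
rewrite distrC (distrC s) !ger0_norm ?subr_ge0//.
have q0 : 0 < q by lra.
rewrite -(mulr_powRB1 t0 q0) -(mulr_powRB1 s0 q0).
set al := q - 1; have al0 : 0 <= al by rewrite /al; lra.
have sal : s `^ al <= M `^ al by rewrite ge0_ler_powR ?nnegrE//; lra.
have tal : t `^ al <= M `^ al by rewrite ge0_ler_powR ?nnegrE//; lra.
have split_al x : 0 <= x -> x = x `^ al * x `^ (1 - al).
  by move=> x0; rewrite -powRD addrC subrK ?powRr1// oner_eq0.
(* After writing [x = x^al x^(1 - al)], this comes down to [s^(1 - al) <= t^(1 - al)], where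
   [q <= 2] enters. *)
have swap : s * t `^ al <= t * s `^ al.
  rewrite {1}(split_al s s0) {2}(split_al t t0) [leRHS]mulrC mulrA.
  rewrite [leLHS]mulrAC; apply: ler_wpM2l; first by rewrite mulr_ge0 ?powR_ge0.
  by rewrite ge0_ler_powR ?nnegrE//; rewrite /al; lra.
have := ler_wpM2r (_ : 0 <= t - s) (lerD sal tal); rewrite subr_ge0 => /(_ st).
lra.
Qed.

(** The argument stands for an eigenvalue of [x^* x]; the truncation at [M] acts on its root, a
    singular value of [x]. *)
Definition cut_pow (q M s : R) : R := (Num.min (s `^ 2^-1) M) `^ q.

Lemma cut_pow_lipschitz (q M s t : R) : 1 < q <= 2 -> 0 <= M ->
  (cut_pow q M (s ^+ 2) - cut_pow q M (t ^+ 2)) ^+ 2 <=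
  (2 * M `^ (q - 1)) ^+ 2 * (s - t) ^+ 2.
Proof.
move=> q12 M0; rewrite /cut_pow !powR12_sqrt ?sqr_ge0// !sqrtr_sqr.
have min_itv (x : R) : 0 <= Num.min `|x| M <= M.
  by rewrite le_min normr_ge0 M0 ge_min lexx orbT.
have := powR_lipschitz q12 (min_itv s) (min_itv t).
set A := _ - _; set K := 2 * _ => AK.
have K0 : 0 <= K by rewrite mulr_ge0// powR_ge0.
rewrite -exprMn -[A ^+ 2]real_normK ?num_real//.
rewrite -[leRHS]real_normK ?num_real// ler_sqr ?nnegrE//.
apply: (le_trans AK); rewrite normrM (ger0_norm K0) ler_wpM2l//.
have := ler_dist_dist s t; rewrite /Num.min.
by case: ltP => sM; case: ltP => tM; rewrite ?subrr ?normr0// !ler_norml;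
  move=> /andP[? ?]; apply/andP; split; lra.
Qed.

Lemma cut_pow_id (q M s : R) : 0 <= M -> 0 <= s <= M ^+ 2 ->
  cut_pow q M s = (s `^ 2^-1) `^ q.
Proof.
move=> M0 /andP[s0 sM]; rewrite /cut_pow min_l// powR12_sqrt//.
by rewrite -(ger0_norm M0) -sqrtr_sqr ler_wsqrtr.
Qed.

End Matrices.

Import numFieldNormedType.Exports.
Local Open Scope classical_set_scope.

(** * Ordinary differential equations with a Lipschitz field *)

Lemma is_derive_cvgP (R : realType) (f : R -> R) (x l : R) :
  is_derive x 1 f l <-> h^-1 * (f (h + x) - f x) @[h --> 0^'] --> l.
Proof.
have E : (fun h : R => h^-1 * (f (h + x) - f x)) =
         (fun h : R => h^-1 *: ((f \o shift x) (h *: (1:R)) - f x)).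
  by apply/funext => h /=; rewrite [h *: 1]mulr1.
split=> [[d e]|c].
  by rewrite E -e; exact: d.
rewrite E in c.
apply: DeriveDef; first by apply/cvg_ex; exists l.
exact/cvg_lim.
Qed.

Lemma is_derive_glue (R : realType) (f g : R -> R) (l : R) : f 0 = g 0 ->
  is_derive (0:R) (1:R) f l -> is_derive (0:R) (1:R) g l ->
  is_derive (0:R) (1:R) (fun x => if 0 <= x then f x else g x) l.
Proof.
move=> fg /is_derive_cvgP/cvgrPdist_lt fl /is_derive_cvgP/cvgrPdist_lt gl.
apply/is_derive_cvgP/cvgrPdist_lt => e e0.
near=> h; rewrite lexx; case: ifPn => _; last rewrite fg; near: h.
- exact: fl.
- exact: gl.
Unshelve. all: by end_near. Qed.

Lemma continuous_primitive_ray (R : realType) (f : R -> R) (a : R) :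
  continuous f -> exists F : R -> R, forall x, a < x -> is_derive x 1 F (f x).
Proof.
move=> cf; exists (fun x => \int[lebesgue_measure]_(t in `[a, x]) f t)%R => x ax.
(* The right end [x + 1] makes [x] interior to the interval of integration. *)
have xx1 : x < x + 1 by rewrite ltrDl.
have fi : lebesgue_measure.-integrable `[a, x + 1]%classic (EFin \o f).
  apply: continuous_compact_integrable; first exact: segment_compact.
  exact: continuous_subspaceT.
have [d e] := continuous_FTC1_closed xx1 fi ax (cf x).
by apply: DeriveDef; [exact: d|rewrite -derive1E; exact: e].
Qed.

(** The integral from -1 is a primitive to the right of -1. Thus [A0] serves for [x > -1], and [B0],
    obtained from the reflected function, for [x < 1]; both vanish at 0 and are glued there. *)
Lemma continuous_primitive (R : realType) (f : R -> R) : continuous f ->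
  exists F : R -> R, F 0 = 0 /\ forall x : R, is_derive x 1 F (f x).
Proof.
move=> cf.
have [A dA] := continuous_primitive_ray (-1) cf.
have cfN : continuous (f \o -%R).
  by move=> x; apply: continuous_comp; [exact: opp_continuous|exact: cf].
have [B dB] := continuous_primitive_ray (-1) cfN.
pose A0 x := A x - A 0; pose B0 x := B 0 - B (- x).
have dA0 (x : R) : -1 < x -> is_derive x 1 A0 (f x).
  move=> x0; have h := dA x x0; rewrite -[f x]subr0.
  rewrite -[A0]/(A - cst (A 0)); exact: is_deriveB.
have dB0 (x : R) : x < 1 -> is_derive x 1 B0 (f x).
  move=> x0; have x1 : -1 < - x by rewrite ltrN2.
  have := dB _ x1; rewrite /= opprK => h.
  have h1 : is_derive x 1 (B \o -%R) (f x * -1) by exact: is_derive1_comp.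
  have -> : f x = 0 - (f x * -1) by rewrite mulrN1 opprK add0r.
  rewrite -[B0]/(cst (B 0) - (B \o -%R)); exact: is_deriveB.
exists (fun x => if 0 <= x then A0 x else B0 x); split.
  by rewrite lexx /A0 subrr.
move=> x; case: (ltrgt0P x) => x0.
- apply: (@near_eq_is_derive _ _ _ A0); [|by apply: dA0; lra].
  by near=> y; rewrite ifT //; near: y; exact: lt_le_nbhsr.
- apply: (@near_eq_is_derive _ _ _ B0); [|by apply: dB0; lra].
  near=> y; rewrite ifF //; apply/negbTE; rewrite -ltNge; near: y.
  exact: lt_nbhsl.
- rewrite x0; apply: is_derive_glue.
  + by rewrite /A0 /B0 oppr0 !subrr.
  + by apply: dA0; lra.
  + by apply: dB0; lra.
Unshelve. all: by end_near. Qed.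

(** * Exponential bounds and geometric convergence *)

Lemma is_derive_expRM (R : realType) (a x : R) :
  is_derive x 1 (fun t => expR (a * t)) (a * expR (a * x)).
Proof.
have h : is_derive x 1 (fun t : R => a * t) a.
  have -> : (fun t : R => a * t) = a \*: (@id R) by [].
  by apply: is_derive_eq; rewrite [LHS]mulr1.
rewrite mulrC; exact: (@is_derive1_comp _ expR).
Qed.

(** [K e^(a t) - f t] has a nonnegative derivative for [t >= 0] and starts at [K >= 0]. *)
Lemma le_expR_growth (R : realType) (f df : R -> R) (K a x : R) :
  0 <= K -> f 0 = 0 -> (forall t : R, is_derive t 1 f (df t)) ->
  (forall t, 0 <= t -> df t <= K * (a * expR (a * t))) -> 0 <= x ->
  f x <= K * expR (a * x).
Proof.
move=> K0 f0 df_ dfle x0.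
pose h := K \*: (fun t => expR (a * t)) - f.
have dh (t : R) : is_derive t 1 h (K * (a * expR (a * t)) - df t).
  apply: is_deriveB; apply: is_deriveZ; exact: is_derive_expRM.
have ch : {within `[0, x], continuous h}.
  apply/continuous_subspaceT => t.
  by apply/differentiable_continuous/derivable1_diffP; case: (dh t).
have [c c0 E] := MVT_segment x0 (fun t _ => dh t) ch.
have : 0 <= h x - h 0.
  rewrite E subr0 mulr_ge0// subr_ge0 dfle//.
  by move: c0; rewrite in_itv/= => /andP[].
have hE t : h t = K * expR (a * t) - f t by [].
by rewrite !hE f0 mulr0 expR0; lra.
Qed.

Lemma le_norm_expR_growth (R : realType) (f df : R -> R) (K a x : R) :
  0 <= K -> f 0 = 0 -> (forall t : R, is_derive t 1 f (df t)) ->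
  (forall t, `|df t| <= K * (a * expR (a * `|t|))) ->
  `|f x| <= K * expR (a * `|x|).
Proof.
move=> K0; wlog x0 : f df x / 0 <= x => [W|] f0 df_ dfle.
  case: (leP 0 x) => x0; first exact: (W f df).
  have := W (fun t => f (- t)) (fun t => - df (- t)) (- x).
  rewrite opprK normrN; apply.
  - by rewrite oppr_ge0 ltW.
  - by rewrite oppr0.
  - move=> t; rewrite -mulrN1; exact: is_derive1_comp.
  - by move=> t; rewrite normrN -(normrN t).
rewrite (ger0_norm x0) ler_norml; apply/andP; split.
  rewrite lerNl.
  apply: (@le_expR_growth _ (- f) (fun t => - df t)) => //.
  - by rewrite !fctE f0 oppr0.
  - move=> t t0; apply: le_trans (ler_norm _) _; rewrite normrN.
    by have := dfle t; rewrite (ger0_norm t0).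
apply: (@le_expR_growth _ f df) => // t t0; apply: le_trans (ler_norm _) _.
by have := dfle t; rewrite (ger0_norm t0).
Qed.

Lemma le_div2X_eq0 (R : realType) (x C : R) :
  (forall k, `|x| <= C / 2 ^+ k) -> x = 0.
Proof.
move=> xC; apply/normr0_eq0/le_anti; rewrite normr_ge0 andbT.
have cv : geometric C 2^-1 @ \oo --> (0 : R).
  by apply: cvg_geometric; rewrite ger0_norm ?invr_ge0// invf_lt1// ltr1n.
rewrite leNgt; apply/negP => x0.
have /cvgrPdist_lt/(_ _ x0)[k _ /(_ k (leqnn k))] := cv.
rewrite /= sub0r normrN exprVn => /(le_lt_trans (ler_norm _)).
by rewrite ltNge xC.
Qed.

(* The nested intervals [u k - 2C/2^k, u k + 2C/2^k] have a common point. *)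
Lemma geometric_cauchy (R : realType) (u : nat -> R) (C : R) :
  (forall k, `|u k.+1 - u k| <= C / 2 ^+ k) ->
  exists l, forall k, `|l - u k| <= 2 * C / 2 ^+ k.
Proof.
move=> uC; pose r k := 2 * C / 2 ^+ k.
have C0 : 0 <= C by have := uC 0%N; rewrite expr0 divr1; apply: le_trans.
have r0 k : 0 <= r k by rewrite divr_ge0 ?mulr_ge0// exprn_ge0.
have rS k : r k.+1 + C / 2 ^+ k = r k.
  have : (2 : R) ^+ k != 0 by rewrite expf_neq0.
  rewrite /r exprS => k0; field; exact: k0.
have lo m n : u m - r m <= u (m + n)%N - r (m + n)%N.
  elim: n => [|n IH]; first by rewrite addn0.
  apply: le_trans IH _; rewrite addnS; have := uC (m + n)%N; have := rS (m + n)%N.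
  by rewrite ler_norml => ? /andP[? ?]; lra.
have hi m n : u (m + n)%N + r (m + n)%N <= u m + r m.
  elim: n => [|n IH]; first by rewrite addn0.
  apply: le_trans IH; rewrite addnS; have := uC (m + n)%N; have := rS (m + n)%N.
  by rewrite ler_norml => ? /andP[? ?]; lra.
have lohi m n : u m - r m <= u n + r n.
  apply: le_trans (lo m n) _; apply: le_trans (hi n m); rewrite (addnC n m).
  by have := r0 (m + n)%N; lra.
pose S := range (fun k => u k - r k).
have ubS n : ubound S (u n + r n) by move=> _ [m _ <-].
exists (sup S) => k; rewrite -/(r k) ler_distl; apply/andP; split.
  by apply: ub_le_sup; [exists (u 0%N + r 0%N)|exists k].
by apply: ge_sup; [exists (u 0%N - r 0%N); exists 0%N|].
Qed.

(** The Lipschitz condition for the sup norm on [I -> R], put as the transfer of a uniform bound. *)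
Definition sup_lipschitz (R : realType) (I : Type) (G : (I -> R) -> I -> R)
    (L : R) :=
  forall u v K, (forall i, `|u i - v i| <= K) ->
    forall i, `|G u i - G v i| <= L * K.

(** * Picard iteration in a weighted sup norm *)

Section PicardLindelof.
Variables (R : realType) (I : finType) (G : (I -> R) -> I -> R) (L : R).
Hypotheses (L0 : 0 < L) (lipG : sup_lipschitz G L).
Implicit Types (u v w : R -> I -> R) (t : R).

Lemma sup_lipschitz_continuous w : (forall i, continuous (w ^~ i)) ->
  forall i, continuous (fun t => G (w t) i).
Proof.
move=> cw i t; apply/cvgrPdist_le => e e0.
(* As [I] is finite, only finitely many neighbourhoods of [t] are intersected. *)
have : \forall s \near t, forall j, `|w t j - w s j| <= e / L.
  apply: (@filter_forall _ I (fun j s => `|w t j - w s j| <= e / L)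
    (nbhs t) (nbhs_filter t)) => j.
  by have /cvgrPdist_le := cw j t; apply; rewrite divr_gt0.
apply: filterS => s ws; have := lipG ws i.
by rewrite mulrCA divff ?mulr1// gt_eqF.
Qed.

Lemma is_derive1_continuous (f df : R -> R) :
  (forall t, is_derive t 1 f (df t)) -> continuous f.
Proof.
move=> fdf t.
by apply/differentiable_continuous/derivable1_diffP; case: (fdf t).
Qed.

(** The derivative of the new gap is at most [L K e^(2 L |t|)], which is [K / 2] times the
    derivative of the weight in [|t|]; hence the halving. *)
Lemma picard_gap u v u' v' (K : R) : 0 <= K -> u' 0 = v' 0 ->
  (forall t i, is_derive t 1 (u' ^~ i) (G (u t) i)) ->
  (forall t i, is_derive t 1 (v' ^~ i) (G (v t) i)) ->
  (forall t i, `|u t i - v t i| <= K * expR (2 * L * `|t|)) ->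
  forall t i, `|u' t i - v' t i| <= K / 2 * expR (2 * L * `|t|).
Proof.
move=> K0 uv0 du dv uv t i.
apply: (@le_norm_expR_growth _ (u' ^~ i - v' ^~ i)
  (fun t => G (u t) i - G (v t) i)).
- by rewrite divr_ge0.
- by rewrite /= !fctE uv0 subrr.
- move=> s; apply: le_trans (lipG (uv s) i) _.
  by rewrite le_eqVlt; apply/orP; left; apply/eqP; field.
Qed.

(** Each solution is its own Picard image, so [picard_gap] halves the weighted gap repeatedly; the
    bound [K] starts the iteration. *)
Lemma lipschitz_ode_unique u v (K : R) : u 0 = v 0 ->
  (forall t i, is_derive t 1 (u ^~ i) (G (u t) i)) ->
  (forall t i, is_derive t 1 (v ^~ i) (G (v t) i)) ->
  (forall t i, `|u t i - v t i| <= K) -> u = v.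
Proof.
move=> uv0 du dv uvK; apply/funext => t; apply/funext => i.
have K0 : 0 <= K by apply: le_trans (uvK 0 i).
have uvk k s j : `|u s j - v s j| <= K / 2 ^+ k * expR (2 * L * `|s|).
  elim: k s j => [|k IH] s j.
    rewrite expr0 divr1; apply: le_trans (uvK s j) _; rewrite ler_peMr//.
    by rewrite -expR0 ler_expR !mulr_ge0// ltW.
  rewrite exprSr invfM mulrA; apply: (picard_gap _ uv0 du dv IH).
  by rewrite divr_ge0 ?exprn_ge0.
apply/eqP; rewrite -subr_eq0; apply/eqP.
apply: (@le_div2X_eq0 _ _ (K * expR (2 * L * `|t|))) => k.
by have := uvk k t i; rewrite mulrAC.
Qed.

Lemma picard_step (w0 : I -> R) w : (forall i, continuous (w ^~ i)) ->
  exists w', w' 0 = w0 /\ forall t i, is_derive t 1 (w' ^~ i) (G (w t) i).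
Proof.
move=> cw.
have /choice[P PE] :=
  fun i => continuous_primitive (@sup_lipschitz_continuous w cw i).
exists (fun t i => w0 i + P i t); split.
  by apply/funext => i; rewrite (PE i).1 addr0.
move=> t i; have h := (PE i).2 t; rewrite -[G _ _]add0r.
rewrite -[fun _ => _]/(cst (w0 i) + P i); exact: is_deriveD.
Qed.

Theorem picard_lindelof (w0 : I -> R) :
  exists w, w 0 = w0 /\ forall t i, is_derive t 1 (w ^~ i) (G (w t) i).
Proof.
pose cont w := forall i, continuous (w ^~ i).
(* [S] is the Picard map, made total by returning a discontinuous curve unchanged. *)
have /choice[S SE] : forall w, exists w', cont w ->
    w' 0 = w0 /\ forall t i, is_derive t 1 (w' ^~ i) (G (w t) i).
  move=> w; have [/(picard_step w0)[w' ?]|?] := pselect (cont w).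
    by exists w'.
  by exists w.
have contS w : cont w -> cont (S w).
  by move=> cw i; apply: is_derive1_continuous => t; exact: (SE w cw).2.
pose W k := iter k S (fun=> w0).
have contW k : cont (W k) by elim: k => [i t|k /contS//]; exact: cvg_cst.
pose a := 2 * L; have a0 : 0 < a by rewrite mulr_gt0.
(* [B] bounds all components of the field at [w0], so [K = B / a] makes [K a e^(a |t|)] dominate the
   derivative of the first iterate. *)
pose B := \sum_i `|G w0 i|; pose K := B / a.
have B0 : 0 <= B by exact: sumr_ge0.
have K0 : 0 <= K by rewrite divr_ge0// ltW.
have exp1 t : 1 <= expR (a * `|t|).
  by rewrite -expR0 ler_expR mulr_ge0// ltW.
have WS k t i : `|W k.+1 t i - W k t i| <= K / 2 ^+ k * expR (a * `|t|).
  elim: k t i => [|k IH] t i.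
    rewrite expr0 divr1.
    apply: (@le_norm_expR_growth _ (W 1%N ^~ i - cst (w0 i)) (fun=> G w0 i)) => //.
    - by rewrite !fctE /W/= (SE _ (contW 0%N)).1 subrr.
    - move=> s; rewrite -[G w0 i]subr0.
      have h := (SE _ (contW 0%N)).2 s i; exact: is_deriveB.
    - move=> s; rewrite mulrA divfK ?gt_eqF//.
      apply: (@le_trans _ _ B); last by rewrite ler_peMr.
      by rewrite /B (bigD1 i)//= lerDl sumr_ge0.
  rewrite exprSr invfM mulrA.
  have [W1 dW1] := SE _ (contW k.+1); have [W2 dW2] := SE _ (contW k).
  apply: (picard_gap _ _ dW1 dW2 IH); last by rewrite W1 W2.
  by rewrite divr_ge0 ?exprn_ge0.
have /choice[w wE] : forall t, exists wt : I -> R, forall i k,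
    `|wt i - W k t i| <= 2 * K / 2 ^+ k * expR (a * `|t|).
  move=> t.
  have /choice[wt wtE] : forall i, exists l, forall k,
      `|l - W k t i| <= 2 * (K * expR (a * `|t|)) / 2 ^+ k.
    by move=> i; apply: geometric_cauchy => k; rewrite mulrAC; exact: WS.
  exists wt => i k; have := wtE i k; rewrite mulrA.
  by rewrite -[2 * K * expR _ / _]mulrAC.
have contw : cont w.
  move=> i t; apply/cvgrPdist_le => e e0.
  (* [C] bounds the weighted error constant for all [|s| <= |t| + 1], so convergence is uniform near
     [t] and the limit inherits continuity. *)
  pose C := 2 * K * expR (a * (`|t| + 1)).
  have [k Ck] : exists k, C / 2 ^+ k <= e / 3.
    have cv : geometric C 2^-1 @ \oo --> (0 : R).
      by apply: cvg_geometric; rewrite ger0_norm ?invr_ge0// invf_lt1// ltr1n.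
    have /cvgrPdist_le/(_ (e / 3)) := cv; rewrite divr_gt0// => /(_ isT).
    case=> k _ /(_ k (leqnn k)); rewrite /= sub0r normrN exprVn => h.
    by exists k; apply: le_trans h; exact: ler_norm.
  have wk s : `|s| <= `|t| + 1 -> `|w s i - W k s i| <= e / 3.
    move=> st; apply: le_trans (wE s i k) _; apply: le_trans Ck.
    rewrite /C mulrAC ler_wpM2r ?invr_ge0 ?exprn_ge0//.
    by apply: ler_wpM2l; [exact: mulr_ge0|rewrite ler_expR ler_wpM2l// ltW].
  have Wk : \forall s \near t, `|W k t i - W k s i| <= e / 3.
    by have /cvgrPdist_le := contW k i t; apply; rewrite divr_gt0.
  near=> s.
  have st : `|s| <= `|t| + 1.
    have : `|t - s| <= 1 by near: s; apply: cvgr_dist_le => //; exact: cvg_id.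
    by move=> ts; have := lerB_dist s t; rewrite distrC; lra.
  have h1 := wk t _; have h2 := wk s st.
  have h3 : `|W k t i - W k s i| <= e / 3 by near: s.
  have {}h1 := h1 (ltac:(lra)).
  move: h1 h2 h3; rewrite !ler_norml => /andP[? ?] /andP[? ?] /andP[? ?].
  by apply/andP; split; lra.
have [Sw0 dSw] := SE _ contw.
suff wS : S w = w by exists w; move: Sw0 dSw; rewrite wS.
(* Both [S w] and [w] lie within half of the order-[k] error of the iterate [W k.+1], so their
   distance is at most that error for every [k]. *)
apply/funext => t; apply/funext => i; apply/eqP; rewrite -subr_eq0; apply/eqP.
apply: (@le_div2X_eq0 _ _ (2 * K * expR (a * `|t|))) => k.
rewrite [leRHS]mulrAC; have [Wk0 dWk] := SE _ (contW k).
have : `|S w t i - W k.+1 t i| <= 2 * K / 2 ^+ k / 2 * expR (a * `|t|).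
  apply: (picard_gap _ _ dSw dWk) => [||s j].
  - by apply: divr_ge0; [exact: mulr_ge0|exact: exprn_ge0].
  - by rewrite Sw0 Wk0.
  - exact: (wE s j k).
have := wE t i k.+1; rewrite exprSr invfM mulrA.
rewrite ![_ / 2 * expR _]mulrAC; set r := 2 * K / 2 ^+ k * _.
by rewrite !ler_norml => /andP[? ?] /andP[? ?]; apply/andP; split; lra.
Unshelve. all: by end_near. Qed.

End PicardLindelof.

(** * The flow *)

Section HamiltonFlow.
Variables (R : realType) (N : nat).
Local Notation C := R[i].
Local Notation I := ('I_N * 'I_N * bool)%type.
Implicit Types (x y : 'M[C]_N).

(** Real coordinates over a finite index type, the setting of the Picard theorem. *)
Definition coords x (k : I) : R :=
  if k.2 then complex.Re (x k.1.1 k.1.2) else complex.Im (x k.1.1 k.1.2).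

Definition of_coords (u : I -> R) : 'M[C]_N :=
  \matrix_(i, j) Complex (u (i, j, true)) (u (i, j, false)).

Lemma coordsK x : of_coords (coords x) = x.
Proof. by apply/matrixP => i j; rewrite mxE /coords/=; case: (x i j). Qed.

Lemma of_coordsK (u : I -> R) : coords (of_coords u) = u.
Proof. by apply/funext => -[[i j] []]; rewrite /coords/= mxE. Qed.

Lemma coords_le_frob x k : coords x k ^+ 2 <= frob x.
Proof.
apply: le_trans (frob_entry x k.1.1 k.1.2); rewrite /coords; case: ifP => _.
  by rewrite lerDl sqr_ge0.
by rewrite lerDr sqr_ge0.
Qed.

Lemma coordsB x y k : coords (x - y) k = coords x k - coords y k.
Proof.
by rewrite /coords !mxE; case: (x _ _) (y _ _) => a b [c d]; case: ifP.
Qed.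

Lemma frob_le_coords x (K : R) : (forall k, `|coords x k| <= K) ->
  frob x <= (2 * N%:R ^+ 2) * K ^+ 2.
Proof.
move=> xK; have sq k : coords x k ^+ 2 <= K ^+ 2.
  rewrite -real_normK ?num_real// ler_sqr ?nnegrE//.
  exact: le_trans (normr_ge0 _) (xK k).
apply: (@le_trans _ _ (\sum_(i < N) \sum_(j < N) 2 * K ^+ 2)).
  apply: ler_sum => i _; apply: ler_sum => j _.
  have := sq (i, j, true); have := sq (i, j, false); rewrite /coords/=; lra.
rewrite !sumr_const !card_ord -mulrnA -[leLHS]mulr_natl natrM; lra.
Qed.

(** The [2 N^2] coordinates give [8 c^2] times [2 N^2 K^2], that is [(4 c N K)^2]; the added 1 keeps
    the constant positive, also for [N = 0]. *)
Lemma coords_gramfield_lipschitz (h : R -> R) (c : R) : 0 <= c ->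
  (forall s t, (h (s ^+ 2) - h (t ^+ 2)) ^+ 2 <= c ^+ 2 * (s - t) ^+ 2) ->
  sup_lipschitz (fun u => coords (gramfield h (of_coords u))) (4 * c * N%:R + 1).
Proof.
move=> c0 hc u v K uvK k; have K0 : 0 <= K by exact: le_trans (uvK k).
have N0 : 0 <= N%:R :> R by [].
have cNK : 0 <= c * N%:R * K by rewrite !mulr_ge0.
apply: (@le_trans _ _ (4 * (c * N%:R * K))); last by lra.
rewrite -ler_sqr ?nnegrE// ?mulr_ge0// real_normK ?num_real// -coordsB.
apply: le_trans (coords_le_frob _ _) _.
apply: le_trans (gramfield_lipschitz _ _ hc) _.
have : frob (of_coords u - of_coords v) <= (2 * N%:R ^+ 2) * K ^+ 2.
  by apply: frob_le_coords => l; rewrite coordsB !of_coordsK.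
move/(ler_wpM2l (_ : 0 <= 8 * c ^+ 2)).
rewrite mulr_ge0 ?sqr_ge0// => /(_ isT) /le_trans; apply.
by rewrite le_eqVlt; apply/orP; left; apply/eqP; ring.
Qed.

Lemma is_derive_sumr n (f : 'I_n -> R -> R) (df : 'I_n -> R) (t : R) :
  (forall i, is_derive t 1 (f i) (df i)) ->
  is_derive t 1 (fun s => \sum_(i < n) f i s) (\sum_(i < n) df i).
Proof. by move=> fdf; rewrite -fct_sumE; exact: is_derive_sum. Qed.

(** The derivative of [frob (w t)] is twice the given sum. The velocity [y] is left general, so that
    both the truncated and the original equation are covered. *)
Lemma frob_conserved (w y : R -> 'M[C]_N) :
  (forall (t : R) k, is_derive t 1 (fun s => coords (w s) k) (coords (y t) k)) ->
  (forall t, \sum_i \sum_j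
     (complex.Re (w t i j) * complex.Re (y t i j) +
      complex.Im (w t i j) * complex.Im (y t i j)) = 0) ->
  forall t, frob (w t) = frob (w 0).
Proof.
move=> dw wy t; apply: (@is_derive_0_is_cst _ (fun t => frob (w t))) => {}t.
rewrite -[X in is_derive _ _ _ X](mulr0 2) -(wy t) mulr_sumr.
apply: is_derive_sumr => i; rewrite mulr_sumr; apply: is_derive_sumr => j.
have -> : 2 * (complex.Re (w t i j) * complex.Re (y t i j) +
               complex.Im (w t i j) * complex.Im (y t i j)) =
    coords (w t) (i, j, true) * coords (y t) (i, j, true) +
    coords (w t) (i, j, true) * coords (y t) (i, j, true) +
    (coords (w t) (i, j, false) * coords (y t) (i, j, false) +
     coords (w t) (i, j, false) * coords (y t) (i, j, false)).
  by rewrite /coords/=; ring.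
have h1 := dw t (i, j, true); have h2 := dw t (i, j, false).
exact: is_deriveD (is_deriveM h1 h1) (is_deriveM h2 h2).
Qed.

Lemma hamfield_cut (q M : R) x : 0 <= M -> frob x <= M ^+ 2 ->
  hamfield q x = gramfield (cut_pow q M) x.
Proof.
move=> M0 xM; rewrite hamfieldE; apply: gramfield_eq => s /andP[s0 sx].
by rewrite cut_pow_id// s0 (le_trans sx).
Qed.

Lemma C1_solution_coords (F : 'M[C]_N -> 'M[C]_N) w0 (w : R -> 'M[C]_N) :
  w 0 = w0 ->
  (forall (t : R) k,
    is_derive t 1 (fun s => coords (w s) k) (coords (F (w t)) k)) ->
  (forall k, continuous (fun t => coords (F (w t)) k)) ->
  C1_solution F w0 w.
Proof.
move=> ww0 dw cw; split => // i j; split.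
  by move=> t; split; [exact: (dw t (i, j, true))|exact: (dw t (i, j, false))].
by split; [exact: (cw (i, j, true))|exact: (cw (i, j, false))].
Qed.

Lemma C1_solution_derive (F : 'M[C]_N -> 'M[C]_N) w0 (w : R -> 'M[C]_N) :
  C1_solution F w0 w ->
  forall (t : R) k, is_derive t 1 (fun s => coords (w s) k) (coords (F (w t)) k).
Proof.
by move=> [_ wF] t [[i j] b]; have [/(_ t)[? ?] _] := wF i j; case: b.
Qed.

Lemma C1_solution_frob (q : R) w0 (w : R -> 'M[C]_N) :
  C1_solution (hamfield q) w0 w -> forall t, frob (w t) = frob w0.
Proof.
move=> wq t; rewrite -wq.1; apply: (frob_conserved (C1_solution_derive wq)).
by move=> {}t; rewrite hamfieldE; exact: gramfield_orthogonal.
Qed.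

End HamiltonFlow.

Theorem theorem2p3 (R : realType) (n N : nat) (hn : (1 <= n)%N)
    (w0 : 'M[R[i]]_N) :
  let p : R := (2 * n)%:R in
  let q : R := p / (p - 1) in
  exists w : R -> 'M[R[i]]_N,
    C1_solution (hamfield q) w0 w /\
    forall v : R -> 'M[R[i]]_N, C1_solution (hamfield q) w0 v -> v = w.
Proof.
move=> p q.
have q12 : 1 < q <= 2.
  have p2 : 2 <= p by rewrite /p ler_nat leq_pmulr.
  have p1 : 0 < p - 1 by lra.
  by rewrite /q ltr_pdivlMr// ler_pdivrMr//; apply/andP; split; lra.
(* Since [(1 + a)^2 >= a] for [a >= 0], singular values stay below [M] on the level set of [frob]
   through [w0], where the two fields therefore agree. *)
pose M := 1 + frob w0; have M0 : 0 <= M by rewrite addr_ge0 ?frob_ge0.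
have frobM x : frob x = frob w0 -> frob x <= M ^+ 2.
  by move=> ->; have := frob_ge0 w0; rewrite /M; nra.
have cutE x : frob x = frob w0 -> hamfield q x = gramfield (cut_pow q M) x.
  by move=> /frobM; exact: hamfield_cut.
pose c := 2 * M `^ (q - 1); have c0 : 0 <= c by rewrite mulr_ge0 ?powR_ge0.
have lipG := coords_gramfield_lipschitz (N := N) c0
  (fun s t => cut_pow_lipschitz s t q12 M0).
have L0 : 0 < 4 * c * N%:R + 1 by rewrite ltr_wpDl// mulr_ge0// mulr_ge0.
have [u [u0 du]] := picard_lindelof L0 lipG (coords w0).
pose w t := of_coords (u t).
have uE t : coords (w t) = u t by exact: of_coordsK.
have w_0 : w 0 = w0 by rewrite /w u0 coordsK.
have dw (t : R) k : is_derive t 1 (fun s => coords (w s) k)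
    (coords (gramfield (cut_pow q M) (w t)) k).
  have -> : (fun s => coords (w s) k) = u ^~ k by apply/funext => s; rewrite uE.
  exact: du.
(* The truncated flow stays on this level set, hence solves the original equation. *)
have frob_w t : frob (w t) = frob w0.
  rewrite -w_0; apply: (frob_conserved dw) => {}t.
  exact: gramfield_orthogonal.
have solw : C1_solution (hamfield q) w0 w.
  apply: C1_solution_coords => // [t k|k].
    by rewrite cutE//; exact: dw.
  have -> : (fun t => coords (hamfield q (w t)) k) =
            (fun t => coords (gramfield (cut_pow q M) (of_coords (u t))) k).
    by apply/funext => t; rewrite cutE.
  apply: (sup_lipschitz_continuous L0 lipG) => l.
  by apply: is_derive1_continuous => t; exact: du.
exists w; split => // v solv.
(* Conversely, any solution of the original equation stays on the level set, hence solves the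
   truncated one. *)
have frob_v := C1_solution_frob solv.
have coordsM x k : frob x = frob w0 -> `|coords x k| <= M.
  move=> /frobM xM; rewrite -ler_sqr ?nnegrE// real_normK ?num_real//.
  exact: le_trans (coords_le_frob x k) xM.
have dv (t : R) k : is_derive t 1 (fun s => coords (v s) k)
    (coords (gramfield (cut_pow q M) (of_coords (coords (v t)))) k).
  by rewrite coordsK -cutE//; exact: (C1_solution_derive solv).
have uv0 : coords (v 0) = u 0 by rewrite u0 solv.1.
(* Conservation of [frob] supplies the global bound on the difference that starts the uniqueness
   argument. *)
have uvM t k : `|coords (v t) k - u t k| <= M + M.
  by rewrite -uE (le_trans (ler_normB _ _))// lerD// coordsM.
have E := @lipschitz_ode_unique _ _ _ _ L0 lipG (fun t => coords (v t)) u _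
  uv0 dv du uvM.
by apply/funext => t; rewrite /w -E coordsK.
Qed.
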